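(* Assume $\mathrm{MA}_{\omega_1}$. Let $W$ be a countable set and let $\mathcal A$ be an uncountable almost disjoint family of subsets of $W$. Then either $\mathcal A$ is anti-Luzin, or $\mathcal A$ contains an uncountable subfamily which is Luzin.
   Context: $\mathrm{MA}_{\omega_1}$: for every ccc partial order and every family of $\omega_1$ dense subsets of it there is a filter meeting all of them. An almost disjoint family is a collection of infinite sets whose pairwise intersections are finite. Let $\mathcal A$ be an uncountable almost disjoint family on a countable set $W$. $\mathcal A$ is Luzin iff there is an enumeration $\mathcal A=\{a_\alpha:\alpha<\omega_1\}$ such that for every finite $w\subseteq W$ and every $\alpha<\omega_1$ the set $\{\beta<\alpha: a_\alpha\cap a_\beta\subseteq w\}$ is finite. $\mathcal A$ is anti-Luzin iff for every uncountable $\mathcal B\subseteq\mathcal A$ there are uncountable $\mathcal C,\mathcal D\subseteq\mathcal B$ with $\bigcup\mathcal C\cap\bigcup\mathcal D$ finite. *)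

(* Defs.v *)
From mathcomp Require Import all_boot.
From mathcomp Require Import boolp classical_sets functions cardinality.
Set Implicit Arguments. Unset Strict Implicit. Unset Printing Implicit Defensive.
Local Open Scope classical_set_scope.

Definition omega1_order (T : Type) (lt : T -> T -> Prop) : Prop :=
  [/\ well_founded lt,
      (forall x, ~ lt x x),
      (forall x y z, lt x y -> lt y z -> lt x z) &
      (forall x y, lt x y \/ x = y \/ lt y x)] /\
  ((forall x, countable [set y | lt y x]) /\ ~ countable [set: T]).

Definition at_most_aleph1 (I : Type) : Prop :=
  exists (T : Type) (lt : T -> T -> Prop) (f : I -> T),
    omega1_order lt /\ injective f.

Definition partial_order (P : Type) (le : P -> P -> Prop) : Prop :=
  [/\ (forall p, le p p),
      (forall p q r, le p q -> le q r -> le p r) &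
      (forall p q, le p q -> le q p -> p = q)].

Definition compatible (P : Type) (le : P -> P -> Prop) (p q : P) : Prop :=
  exists r, le r p /\ le r q.

Definition antichain (P : Type) (le : P -> P -> Prop) (X : set P) : Prop :=
  forall p q, X p -> X q -> p <> q -> ~ compatible le p q.

Definition ccc (P : Type) (le : P -> P -> Prop) : Prop :=
  forall X : set P, antichain le X -> countable X.

Definition dense (P : Type) (le : P -> P -> Prop) (D : set P) : Prop :=
  forall p, exists2 q, D q & le q p.

Definition filter_of (P : Type) (le : P -> P -> Prop) (G : set P) : Prop :=
  [/\ G !=set0,
      (forall p q, G p -> le p q -> G q) &
      (forall p q, G p -> G q -> exists2 r, G r & le r p /\ le r q)].

Definition MA_omega1 : Prop :=
  forall (P : Type) (le : P -> P -> Prop),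
    inhabited P -> partial_order le -> ccc le ->
    forall (I : Type) (D : I -> set P),
      at_most_aleph1 I -> (forall i, dense le (D i)) ->
      exists G : set P, filter_of le G /\ forall i, G `&` D i !=set0.

Definition almost_disjoint (W : Type) (A : set (set W)) : Prop :=
  (forall a, A a -> ~ finite_set a) /\
  (forall a b, A a -> A b -> a <> b -> finite_set (a `&` b)).

Definition luzin (W : Type) (A : set (set W)) : Prop :=
  exists (T : Type) (lt : T -> T -> Prop) (e : T -> set W),
    [/\ omega1_order lt, injective e, range e = A &
        forall (w : set W) (alpha : T), finite_set w ->
          finite_set [set beta | lt beta alpha /\ e alpha `&` e beta `<=` w]].

Definition anti_luzin (W : Type) (A : set (set W)) : Prop :=
  forall B, B `<=` A -> ~ countable B ->
    exists C D : set (set W),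
      [/\ C `<=` B, D `<=` B, ~ countable C, ~ countable D &
          finite_set ((\bigcup_(c in C) c) `&` (\bigcup_(d in D) d))].

(* Main.v *)
From mathcomp Require Import wochoice.
Require Import Defs.
From mathcomp Require Import all_boot.
From mathcomp Require Import boolp classical_sets functions cardinality.
Set Implicit Arguments. Unset Strict Implicit. Unset Printing Implicit Defensive.
Local Open Scope classical_set_scope.

(** If [A] is not anti-Luzin, it contains [omega_1] many sets [e x] such that no
two uncountable subfamilies have unions with finite intersection.  Force with
finite subsets of [omega_1], ordered so that a point [y] added to a condition
[p] has to satisfy [e x] meets [e y] beyond [size p] for all [x > y] in [p].
Given two uncountable families of sets, some point [w], as far out as desired,
belongs to uncountably many members of each, so both families can be thinned out
until every member of one meets every member of the other beyond [n].  Applied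
coordinatewise to the tails of a Delta-system this shows that every uncountable
set of conditions has a member compatible with uncountably many others.  This
gives the countable chain condition, and a condition below which a generic set is
unbounded in [omega_1]; that set indexes a Luzin subfamily. *)

(** * Countable and uncountable sets *)

Lemma subset_countable (U : Type) (A B : set U) :
  A `<=` B -> countable B -> countable A.
Proof. by move=> /subset_card_le; apply: sub_countable. Qed.

Lemma countable_setU (U : Type) (A B : set U) :
  countable A -> countable B -> countable (A `|` B).
Proof.
move=> cA cB; apply: subset_countable (_ : countable (\bigcup_(b in [set: bool])
  if b then A else B)); last by apply: bigcup_countable => // -[].
by move=> x [Ax|Bx]; [exists true|exists false].
Qed.

Lemma countable_image (U V : Type) (f : U -> V) (A : set U) :
  countable A -> countable (f @` A).
Proof. exact: sub_countable (card_image_le f A). Qed.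

Lemma countable_fibers (U V : Type) (f : U -> V) (A : set U) :
  countable (f @` A) -> (forall y, countable (A `&` [set x | f x = y])) ->
  countable A.
Proof.
move=> cfA cf; apply: subset_countable (bigcup_countable cfA (fun y _ => cf y)).
by move=> x Ax; exists (f x) => //; exists x.
Qed.

Lemma countable_preimage (U V : Type) (f : U -> V) (A : set V) :
  injective f -> countable A -> countable (f @^-1` A).
Proof.
move=> finj /countable_injP[g ginj]; apply/countable_injP; exists (g \o f).
by move=> x y; rewrite !inE => Ax Ay /= /ginj /[!inE] /(_ Ax Ay) /finj.
Qed.

Lemma uncountable_image (U V : Type) (f : U -> V) (A : set U) :
  injective f -> ~ countable A -> ~ countable (f @` A).
Proof.
move=> finj ncA /(countable_preimage finj) c; apply: ncA.
by apply: subset_countable c => x Ax; exists x.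
Qed.

Lemma sval_inj (U : Type) (P : U -> Prop) : injective (@sval U P).
Proof. by move=> x y; apply: eq_sig_hprop => *; exact: Prop_irrelevance. Qed.

Lemma uncountable_setD (U : Type) (A B : set U) :
  ~ countable A -> countable B -> ~ countable (A `\` B).
Proof.
move=> ncA cB cAB; apply: ncA; apply: subset_countable (countable_setU cAB cB).
by move=> x Ax; have [|] := pselect (B x); [right|left].
Qed.

Lemma uncountable_nonempty (U : Type) (A : set U) : ~ countable A -> A !=set0.
Proof.
by move=> ncA; apply/set0P/eqP => A0; apply: ncA; rewrite A0; exact: countable0.
Qed.

(** * Well-orders and copies of omega_1 *)

Definition strict_well_order (U : Type) (lt : U -> U -> Prop) : Prop :=
  [/\ well_founded lt,
      (forall x, ~ lt x x),
      (forall x y z, lt x y -> lt y z -> lt x z) &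
      (forall x y, lt x y \/ x = y \/ lt y x)].

Lemma strict_well_order_preim (U V : Type) (lt : V -> V -> Prop) (f : U -> V) :
  injective f -> strict_well_order lt ->
  strict_well_order (fun x y => lt (f x) (f y)).
Proof.
move=> finj [wf irr tr tot]; split=> [|x|x y z|x y].
- move=> x; have [y fxy] : exists y, f x = y by exists (f x).
  elim: (wf y) x fxy => {}y _ IH x fxy.
  by split=> z fzx; apply: (IH (f z)) => //; rewrite -fxy.
- exact: irr.
- exact: tr.
- have [|[/finj|]] := tot (f x) (f y); tauto.
Qed.

Lemma exists_strict_well_order (U : eqType) :
  exists lt : U -> U -> Prop, strict_well_order lt.
Proof.
have [R Rwo] := well_ordering_principle U.
have woC : wo_chain R predT by move=> A _; exact: Rwo.
have Rtot x y : R x y || R y x by apply: (wo_chainW woC); rewrite inE.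
have Ranti x y : R x y -> R y x -> x = y.
  by move=> Rxy Ryx; apply: (wo_chain_antisymmetric woC _ _ _); rewrite ?inE ?Rxy ?Ryx.
exists (fun x y => ~~ R y x).
have minR (A : set U) : A !=set0 ->
    exists2 z, A z & forall y, A y -> R z y.
  move=> [a Aa]; have [|z [[Az zmin] _]] := Rwo [pred x | `[<A x>]].
    by exists a; exact/asboolP.
  exists z; first exact/asboolP.
  by move=> y Ay; apply: zmin; exact/asboolP.
split=> [x|x|x y z|x y].
- apply: contrapT => nAcc.
  have [z nAz zmin] := minR [set x | ~ Acc (fun x y => ~~ R y x) x] (ex_intro _ x nAcc).
  by apply: nAz; split=> y nRzy; apply: contrapT => /zmin; apply/negP.
- by have := Rtot x x; rewrite orbb => ->.
- move=> nRyx nRzy.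
  (* Transitivity is read off from the least of the three points: if it is [y] or [z], a hypothesis
     fails; if it is [x], then [R z x] would give [z = x] and so [R z y]. *)
  have [w wP wmin] := minR [set x; y; z] (ex_intro _ x (or_introl (or_introl erefl))).
  have [wx wy wz] : [/\ R w x, R w y & R w z].
    by split; apply: wmin; [left; left|left; right|right].
  move: wP => [[]|] /= e; subst w.
  + apply/negP => Rzx; move/negP: nRzy; apply.
    by rewrite (Ranti _ _ Rzx wz).
  + by rewrite wx in nRyx.
  + by rewrite wy in nRzy.
- have [Rxy|nRxy] := boolP (R x y); last by right; right.
  have [Ryx|nRyx] := boolP (R y x); last by left.
  by right; left; apply: Ranti.
Qed.

(** Well-order [B] and keep the points with countably many predecessors. If these were countable in
    number, some point would be left out; the least such has only kept points below it, hence
    countably many predecessors. *)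
Lemma exists_omega1_subset (U : Type) (B : set U) : ~ countable B ->
  exists (T : eqType) (lt : rel T) (e : T -> U),
    [/\ omega1_order lt, injective e & range e `<=` B].
Proof.
move=> ncB; pose V : eqType := {classic {x | B x}}.
have ncV : ~ countable [set: V].
  move=> cV; apply: ncB; apply: sub_countable cV.
  rewrite -[[set: V]]/[set: {x | B x}].
  apply: card_le_trans (card_image_le (@proj1_sig U B) setT).
  by apply: subset_card_le => x Bx; exists (exist _ x Bx).
have [lt ltwo] := exists_strict_well_order V.
pose T : eqType := {x : V | `[<countable [set y | lt y x]>]}.
have vinj : injective (val : T -> V) by exact: val_inj.
(* The order is made boolean so that conditions can be [sorted] lists. *)
exists T, (fun x y => `[<lt (val x) (val y)>]), (fun x => proj1_sig (val x)).
have cT (x : T) : countable [set y | lt y (val x)] by have /asboolP := valP x.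
split; last by move=> _ [x _ <-]; exact: (proj2_sig (val x : {x | B x})).
- have -> : (fun x y : T => `[<lt (val x) (val y)>] : Prop) =
    (fun x y : T => lt (val x) (val y)).
    by apply/funext => x; apply/funext => y; rewrite asboolE.
  split; first exact: strict_well_order_preim vinj ltwo.
  split=> [x|cTT]; first exact: (countable_preimage vinj (cT x)).
  have cI : countable [set v | countable [set y | lt y v]].
    apply: subset_countable (countable_image val cTT) => v cv.
    by exists (exist _ v (introT (asboolP _) cv)).
  have [wf _ tr tot] := ltwo.
  have [v [nIv vmin]] : exists v, ~ countable [set y | lt y v] /\
      forall u, lt u v -> countable [set y | lt y u].
    have [v [_ nIv]] : ([set: V] `\` [set v | countable [set y | lt y v]]) !=set0.
      by apply: uncountable_nonempty; apply: uncountable_setD.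
    elim: (wf v) nIv => {}v _ IH nIv.
    have [h|h] := pselect (exists2 u, lt u v & ~ countable [set y | lt y u]).
      by case: h => u /IH.
    by exists v; split=> // u uv; apply: contrapT => nu; apply: h; exists u.
  by apply: nIv; apply: subset_countable cI => u /vmin.
- by move=> x y /= exy; apply: vinj; exact: sval_inj exy.
Qed.

(** * Bounds in omega_1 and uncountable families of finite sequences *)

Section Omega1.
Variables (T : eqType) (lt : rel T).
Hypothesis ltT : omega1_order lt.

Let ltirr : irreflexive lt.
Proof. by case: ltT => -[_ irr _ _] _ x; apply/negP; exact: irr. Qed.

Let lttr : transitive lt.
Proof. by case: ltT => -[_ _ tr _] _ y x z; exact: tr. Qed.

Let lt_total (x y : T) : [\/ lt x y, x = y | lt y x].
Proof.
by case: ltT => -[_ _ _ tot] _; have [|[|]] := tot x y; constructor.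
Qed.

Let countable_lt (x : T) : countable [set y | lt y x].
Proof. by case: ltT => _ []. Qed.

Let uncountableT : ~ countable [set: T].
Proof. by case: ltT => _ []. Qed.

(** If no point lay strictly above [C], the closed initial segments up to points of [C], each
    countable, would cover [T]. *)
Lemma countable_bounded (C : set T) :
  countable C -> exists g, forall x, C x -> lt x g.
Proof.
move=> cC; apply: contrapT => nb; apply: uncountableT.
have cD x : countable ([set y | lt y x] `|` [set x]).
  by apply: countable_setU (countable_lt x) (countable1 x).
apply: subset_countable (bigcup_countable cC (fun x _ => cD x)) => g _.
apply: contrapT => ng; apply: nb; exists g => x Cx.
have [//||] := lt_total x g => h; exfalso; apply: ng; exists x => //=.
  by right.
by left.
Qed.

Lemma seq_bounded (s : seq T) (x : T) :
  exists2 g, lt x g & forall y, y \in s -> lt y g.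
Proof.
have [] := @countable_bounded [set` x :: s].
  exact: finite_set_countable (finite_seq _).
move=> g bg; exists g; first by apply: bg; rewrite /= mem_head.
by move=> y ys; apply: bg; rewrite /= inE ys orbT.
Qed.

(* [m] is the length of a longest initial segment shared by uncountably many
   members of [X]; it plays the role of the root of a Delta-system. *)
Lemma exists_common_prefix (x0 : T) (k : nat) (X : set (seq T)) :
  ~ countable X -> (forall s, X s -> size s = k) ->
  exists m r (X0 : set (seq T)),
    [/\ m < k, X0 `<=` X, ~ countable X0, (forall s, X0 s -> take m s = r) &
        forall x, countable (X0 `&` [set s | nth x0 s m = x])].
Proof.
move=> ncX sX.
pose P m := `[<exists r, ~ countable (X `&` [set s | take m s = r])>].
have exP : exists m, P m.
  exists 0; apply/asboolP; exists [::] => cX; apply: ncX.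
  by apply: subset_countable cX => s Xs; split=> //=; rewrite take0.
have ltP m : P m -> m < k.
  move=> /asboolP[r nc]; rewrite ltnNge; apply/negP => km; apply: nc.
  apply: subset_countable (countable1 r) => s [Xs /= <-].
  by rewrite take_oversize // (sX _ Xs).
have [m Pm mmax] := ex_maxnP exP (fun m Pm => ltnW (ltP m Pm)).
have [r ncr] := asboolP _ Pm.
exists m, r, (X `&` [set s | take m s = r]); split=> //.
- exact: ltP.
- by move=> s [].
- move=> x; apply: contrapT => nc.
  suff /mmax : P m.+1 by rewrite ltnn.
  (* An uncountable fibre over [x] would make [rcons r x] a longer shared prefix, against the
     maximality of [m]. *)
  apply/asboolP; exists (rcons r x) => c; apply: nc.
  apply: subset_countable c => s [[Xs /= sr] sx]; split=> //=.
  by rewrite (take_nth x0) ?sr ?sx // (sX _ Xs) ltP.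
Qed.

(** * Linked families, the forcing and its chain condition *)

Section Forcing.
Variables (W : Type) (f : W -> nat) (e : T -> set W).
Hypothesis finj : injective f.
Hypothesis einj : injective e.
Hypothesis no_split : forall C D : set (set W),
  C `<=` range e -> D `<=` range e -> ~ countable C -> ~ countable D ->
  ~ finite_set ((\bigcup_(c in C) c) `&` (\bigcup_(d in D) d)).

(** The injection [f] lets numbers stand for finite subsets of [W]: each finite set lies below some
    [n], and only finitely many points do. *)
Definition meet_beyond (n : nat) (x y : T) : Prop :=
  exists2 w, n <= f w & e x w /\ e y w.

Lemma meet_beyond_sym n x y : meet_beyond n x y -> meet_beyond n y x.
Proof. by case=> w nw [? ?]; exists w. Qed.

Lemma meet_beyond_leq m n x y : m <= n -> meet_beyond n x y -> meet_beyond m x y.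
Proof. by move=> mn [w nw exy]; exists w => //; exact: leq_trans nw. Qed.

Let countable_W (A : set W) : countable A.
Proof. by apply/countable_injP; exists f => x y _ _ /finj. Qed.

Let finite_below (n : nat) : finite_set [set w | f w < n].
Proof.
by apply: (@finite_preimage _ _ `I_n) (finite_II n) => x y _ _ /finj.
Qed.

(** Call a point rare if it lies in only countably many members. As [W] is countable, dropping all
    members through rare points leaves both families uncountable, so by [no_split] their unions
    still share a point beyond [n], and that point is rare for neither. *)
Lemma exists_common_point (n : nat) (C D : set T) :
  ~ countable C -> ~ countable D ->
  exists w, [/\ n <= f w, ~ countable (C `&` [set x | e x w]) &
                ~ countable (D `&` [set x | e x w])].
Proof.
move=> ncC ncD; apply: contrapT => now.
pose rare (A : set T) := \bigcup_(w in [set w | countable (A `&` [set x | e x w])])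
  (A `&` [set x | e x w]).
have ncE (A : set T) : ~ countable A -> ~ countable (e @` (A `\` rare A)).
  move=> ncA; apply: uncountable_image einj _; apply: uncountable_setD ncA _.
  exact: bigcup_countable.
have sub (A : set T) : e @` A `<=` range e by move=> _ [x _ <-]; exists x.
apply: (no_split (sub _) (sub _) (ncE C ncC) (ncE D ncD)).
apply: sub_finite_set (finite_below n) => w [[_ [x [Cx nx] <-] xw] [_ [y [Dy ny] <-] yw]].
rewrite /= ltnNge; apply/negP => nw; apply: now; exists w; split=> // c.
  by apply: nx; exists w.
by apply: ny; exists w.
Qed.

(** Each pair [(i, j)] of [L] is served by one point [w]: keep the sequences of [X] whose [i]-th set
    contains [w] and those of [Y] whose [j]-th set does. Countable fibres ensure that uncountably
    many sequences show uncountably many entries at each position in [I]. *)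
Lemma exists_linked (x0 : T) (n : nat) (I : set nat) (X0 : set (seq T))
    (L : seq (nat * nat)) :
  (forall i x, I i -> countable (X0 `&` [set s | nth x0 s i = x])) ->
  (forall ij, ij \in L -> I ij.1 /\ I ij.2) ->
  forall X Y, X `<=` X0 -> Y `<=` X0 -> ~ countable X -> ~ countable Y ->
  exists X' Y', [/\ X' `<=` X, Y' `<=` Y, ~ countable X', ~ countable Y' &
    forall s t ij, X' s -> Y' t -> ij \in L ->
      meet_beyond n (nth x0 s ij.1) (nth x0 t ij.2)].
Proof.
move=> cfib; elim: L => [|[i j] L IH] LI X Y XX0 YX0 ncX ncY.
  by exists X, Y; split.
have [/= Ii Ij] := LI (i, j) (mem_head _ _).
have nc_nth (l : nat) (Z : set (seq T)) : I l -> Z `<=` X0 -> ~ countable Z ->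
    ~ countable ((nth x0 ^~ l) @` Z).
  move=> Il ZX0 ncZ cZ; apply: ncZ; apply: countable_fibers cZ _ => x.
  by apply: subset_countable (cfib l x Il) => s [/ZX0 ? ?]; split.
have [w [nw ncXw ncYw]] :=
  exists_common_point n (nc_nth i X Ii XX0 ncX) (nc_nth j Y Ij YX0 ncY).
pose at_w (l : nat) := [set s : seq T | e (nth x0 s l) w].
have nc_at (l : nat) (Z : set (seq T)) :
    ~ countable ((nth x0 ^~ l) @` Z `&` [set x | e x w]) -> ~ countable (Z `&` at_w l).
  move=> nc c; apply: nc; apply: subset_countable (countable_image (nth x0 ^~ l) c).
  by move=> _ [[s Zs <-] sw]; exists s.
have [|||X' [Y' [X'X Y'Y ncX' ncY' X'Y']]] :=
  IH _ (X `&` at_w i) (Y `&` at_w j) _ _ (nc_at i X ncXw) (nc_at j Y ncYw).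
- by move=> ij ijL; apply: LI; rewrite inE ijL orbT.
- by move=> s [/XX0].
- by move=> s [/YX0].
exists X', Y'; split=> //; [by move=> s /X'X[]|by move=> s /Y'Y[]|].
move=> s t ij X's Y't; rewrite inE => /predU1P[->|ijL]; last exact: X'Y'.
by exists w => //; split; [case: (X'X _ X's)|case: (Y'Y _ Y't)].
Qed.

(* No separate natural-number component is needed in a condition: the sizes of
   the members of a generic filter are unbounded. *)
Definition extends (q p : seq T) : Prop :=
  {subset p <= q} /\
  forall x y, x \in p -> y \in q -> y \notin p -> lt y x ->
    meet_beyond (size p) x y.

Lemma extends_refl p : extends p p.
Proof. by split=> // x y _ ->. Qed.

Lemma extends_size p q : sorted lt p -> extends q p -> size p <= size q.
Proof. by move=> sp [pq _]; apply: uniq_leq_size pq; exact: sorted_uniq sp. Qed.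

(** Points added in the second step are linked beyond [size q], which is at least [size p] because
    [p] has no repetitions. *)
Lemma extends_trans p q r :
  sorted lt p -> extends q p -> extends r q -> extends r p.
Proof.
move=> sp qp rq; split=> [x /qp.1/rq.1//|x y xp yr nyp yx].
have [yq|nyq] := boolP (y \in q); first exact: qp.2.
by apply: meet_beyond_leq (extends_size sp qp) _; apply: rq.2 => //; exact: qp.1.
Qed.

(** Strictly increasing lists represent each finite set only once, which gives antisymmetry. *)
Lemma extends_anti p q : sorted lt p -> sorted lt q ->
  extends q p -> extends p q -> p = q.
Proof.
move=> sp sq [pq _] [qp _]; apply: (irr_sorted_eq lttr ltirr) sp sq _ => x.
by apply/idP/idP => [/pq|/qp].
Qed.

(** Pass to sequences of one length [k] with a maximal common prefix and link the tails beyond [k].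
    For [s] in [X'] and [t] in [Y'] with its tail above [s], the union [s ++ drop m t] extends both:
    nothing is added below a point of [s], and what [t] gains is the tail of [s], which lies above
    the prefix and is linked to the tail of [t]. *)
Lemma exists_many_compatible (X : set (seq T)) :
  ~ countable X -> (forall s, X s -> sorted lt s) ->
  exists2 p, X p & ~ countable (X `&`
    [set q | exists r, [/\ sorted lt r, extends r p & extends r q]]).
Proof.
move=> ncX sX; have [x0 _] := uncountable_nonempty uncountableT.
have [k ncXk] : exists k, ~ countable (X `&` [set s | size s = k]).
  apply: contrapT => h; apply: ncX; apply: (@countable_fibers _ _ size) => [|k].
    exact: countableP.
  by apply: contrapT => nc; apply: h; exists k.
have [|m [r [X0 [mk X0X ncX0 X0r X0m]]]] := exists_common_prefix x0 (k := k) ncXk.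
  by move=> s [].
have sX0 s : X0 s -> sorted lt s by move=> /X0X[/sX].
have kX0 s : X0 s -> size s = k by move=> /X0X[].
have X0le x : countable (X0 `&` [set s | ~~ lt x (nth x0 s m)]).
  have cD : countable ([set y | lt y x] `|` [set x]).
    by apply: countable_setU (countable_lt x) (countable1 x).
  apply: subset_countable (bigcup_countable cD (fun y _ => X0m y)) => s [X0s /= nlt].
  exists (nth x0 s m) => //; have [h|h|h] := lt_total x (nth x0 s m).
  + by rewrite h in nlt.
  + by right.
  + by left.
have ltnth s i : X0 s -> m <= i -> i < k -> i = m \/ lt (nth x0 s m) (nth x0 s i).
  move=> X0s; rewrite leq_eqVlt => /predU1P[->|mi ik]; [by left|right].
  by apply: (sorted_ltn_nth lttr) => //; rewrite ?inE ?(kX0 _ X0s) ?sX0.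
(* Entries from position [m] on are at least the entry at [m], so the value [x] there keeps the
   entry at [m] from exceeding [x], which happens only countably often. *)
have X0fib i x : [set i | m <= i < k] i -> countable (X0 `&` [set s | nth x0 s i = x]).
  move=> /= /andP[mi ik]; apply: subset_countable (X0le x) => s [X0s /= <-].
  split=> //=; apply/negP => lti; have [ei|lti'] := ltnth s i X0s mi ik.
    by rewrite ei ltirr in lti.
  by have := lttr lti lti'; rewrite ltirr.
pose L := [seq (i, j) | i <- iota m (k - m), j <- iota m (k - m)].
have memL i : (i \in iota m (k - m)) = (m <= i < k) by rewrite mem_iota subnKC // ltnW.
have [|X' [Y' [X'X0 Y'X0 ncX' ncY' linked]]] := @exists_linked x0 k _ X0 L X0fib
    _ X0 X0 (fun _ => id) (fun _ => id) ncX0 ncX0.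
  by move=> _ /allpairsP[[i j] [/= + + ->]]; rewrite !memL.
have mem_tail s y : X0 s -> y \in drop m s -> exists2 i, m <= i < k & y = nth x0 s i.
  move=> X0s /(nthP x0)[i]; rewrite size_drop (kX0 _ X0s) ltn_subRL nth_drop => ik <-.
  by exists (m + i) => //; rewrite leq_addr.
have tail_gt s x y : X0 s -> x \in take m s -> y \in drop m s -> lt x y.
  move=> X0s xs ys; have := sX0 _ X0s; rewrite sorted_pairwise // -{1}(cat_take_drop m s).
  by rewrite pairwise_cat => /andP[/allrelP/(_ _ _ xs ys)].
have [s X's] := uncountable_nonempty ncX'; have X0s := X'X0 _ X's.
exists s; first by have [] := X0X _ X0s.
have [g _ sg] := seq_bounded s x0.
(* All but countably many [t] have their tail above the bound [g] of [s]. *)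
move=> c; apply: (uncountable_setD ncY' (X0le g)); apply: subset_countable c => t [Y't nt].
have X0t := Y'X0 _ Y't; split; first by have [] := X0X _ X0t.
have gt : lt g (nth x0 t m) by apply: contrapT => /negP h; apply: nt.
have s_lt x y : x \in s -> y \in drop m t -> lt x y.
  move=> /sg xg /(mem_tail _ _ X0t)[i /andP[mi ik] ->].
  by have [->|/(lttr gt)/(lttr xg)//] := ltnth t i X0t mi ik; exact: lttr xg gt.
exists (s ++ drop m t); split.
- rewrite sorted_pairwise // pairwise_cat -!sorted_pairwise // drop_sorted ?sX0 // !andbT.
  by apply/allrelP => x y; exact: s_lt.
- split=> [x|x y xs]; first by rewrite mem_cat => ->.
  by rewrite mem_cat => /orP[->//|/(s_lt _ _ xs) xy] _ /(lttr xy); rewrite ltirr.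
- have takest : take m t = take m s by rewrite !X0r.
  split=> [x|x y xt]; rewrite mem_cat.
    rewrite -{1}(cat_take_drop m t) mem_cat takest => /orP[/mem_take->//|->].
    by rewrite orbT.
  move=> /orP[ys|/mem_drop->//] nyt yx.
  have ytail : y \in drop m s.
    move: ys; rewrite -{1}(cat_take_drop m s) mem_cat -takest => /orP[/mem_take|//].
    by move=> yt; rewrite yt in nyt.
  move: xt; rewrite -{1}(cat_take_drop m t) mem_cat takest => /orP[xs|xtail].
    by have := lttr yx (tail_gt _ _ _ X0s xs ytail); rewrite ltirr.
  have [i mik yi] := mem_tail _ _ X0s ytail; have [j mjk xj] := mem_tail _ _ X0t xtail.
  rewrite (kX0 _ X0t) xj yi; apply: meet_beyond_sym; apply: (linked s t (i, j)) => //.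
  by apply/allpairsP; exists (i, j); rewrite !memL.
Qed.

(** Otherwise every [[:: a]] has an extension containing [a] all of whose extensions stay below a
    fixed bound. One of these is compatible with uncountably many others, and each common extension
    puts the other's index [b] under the same bound, leaving only countably many [b]. *)
Lemma exists_unbounding_condition : exists2 p0, sorted lt p0 &
  forall q, sorted lt q -> extends q p0 -> forall g, exists r,
    [/\ sorted lt r, extends r q & exists2 x, x \in r & lt g x].
Proof.
apply: contrapT => no_p0.
have bounded a : exists qg : seq T * T, [/\ sorted lt qg.1, a \in qg.1 &
    forall r, sorted lt r -> extends r qg.1 -> forall x, x \in r -> ~~ lt qg.2 x].
  apply: contrapT => na; apply: no_p0; exists [:: a] => // q sq qa g.
  apply: contrapT => nr; apply: na; exists (q, g); split=> //=.
    by apply: qa.1; rewrite mem_head.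
  move=> r sr rq x xr; apply/negP => gx; apply: nr; exists r; split=> //.
  by exists x.
have [qg qgP] := choice bounded.
(* A condition is finite and contains every [a] to which it is assigned, so each is assigned to
   finitely many [a]. *)
have ncQ : ~ countable (range (fst \o qg)).
  move=> cQ; apply: uncountableT; apply: countable_fibers cQ _ => q.
  apply: subset_countable (_ : countable [set` q]); last first.
    exact: finite_set_countable (finite_seq _).
  by move=> a [_ /= <-]; case: (qgP a).
have [|p [a _ pa]] := exists_many_compatible ncQ.
  by move=> _ [a _ <-]; case: (qgP a).
apply; set g := (qg a).2.
have cD : countable ([set y | lt y g] `|` [set g]).
  by apply: countable_setU (countable_lt g) (countable1 g).
apply: subset_countable (countable_image (fst \o qg) cD).
move=> _ [[b _ <-] [r [sr rp rq]]]; exists b => //.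
have [_ bq _] := qgP b; have [_ _ aP] := qgP a.
have nlt : ~~ lt g b by apply: (aP r) => //; [move: rp; rewrite -pa|exact: rq.1].
have [h|h|h] := lt_total g b; [by rewrite h in nlt|by right|by left].
Qed.

(** * The generic Luzin subfamily *)

Hypothesis MA : MA_omega1.

Lemma exists_luzin : exists B : set (set W), [/\ B `<=` range e, ~ countable B & luzin B].
Proof.
have [p0 sp0 p0P] := exists_unbounding_condition.
pose P := {p : seq T | sorted lt p /\ extends p p0}.
pose le (q p : P) := extends (sval q) (sval p).
have leP : partial_order le.
  split=> [p|p q r|p q].
  - exact: extends_refl.
  - by move=> pq qr; apply: extends_trans qr pq; case: (svalP r).
  - move=> pq qp; have [sp _] := svalP p; have [sq _] := svalP q.
    exact: sval_inj (extends_anti sp sq qp pq).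
have cccP : ccc le.
  move=> X antiX; apply: contrapT => ncX.
  have ncsX := uncountable_image (@sval_inj _ _) ncX.
  have [|_ [p Xp <-]] := exists_many_compatible ncsX.
    by move=> _ [p _ <-]; case: (svalP p).
  apply; apply: subset_countable (countable1 (sval p)).
  move=> _ [[q Xq <-] [r [sr rp rq]]] /=; apply: contrapT => qp.
  apply: (antiX p q Xp Xq); first by move=> pq; apply: qp; rewrite pq.
  have rp0 : extends r p0 by apply: extends_trans sp0 (svalP p).2 rp.
  by exists (exist _ r (conj sr rp0)).
pose D (g : T) := [set p : P | exists2 x, x \in sval p & lt g x].
have denseD g : dense le (D g).
  move=> q; have [sq qp0] := svalP q; have [r [sr rq rg]] := p0P _ sq qp0 g.
  by exists (exist _ r (conj sr (extends_trans sp0 qp0 rq))).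
have T1 : at_most_aleph1 T by exists T, (fun x y => lt x y), id; split.
have [|G [[[p1 Gp1] _ Gdir] GD]] := MA _ leP cccP T1 denseD.
  by constructor; exists p0; split=> //; exact: extends_refl.
pose I := [set x | exists2 p : P, G p & x \in sval p].
have Iunbounded g : exists2 x, I x & lt g x.
  by have [p [Gp [x xp gx]]] := GD g; exists x => //; exists p.
have ncI : ~ countable I.
  move=> /countable_bounded[g Ig]; have [x Ix gx] := Iunbounded g.
  by have := lttr gx (Ig _ Ix); rewrite ltirr.
(* A member of the filter grows by absorbing a point of [I] above all its entries. *)
have Gsize n : exists2 p : P, G p & n <= size (sval p).
  elim: n => [|n [p Gp np]]; first by exists p1.
  have [x0 _] := uncountable_nonempty uncountableT.
  have [g _ pg] := seq_bounded (sval p) x0.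
  have [x [q Gq xq] gx] := Iunbounded g.
  have [r Gr [rp rq]] := Gdir _ _ Gp Gq; exists r => //.
  have ux : uniq (x :: sval p).
    rewrite /= (sorted_uniq lttr ltirr (svalP p).1) andbT; apply/negP => /pg xg.
    by have := lttr gx xg; rewrite ltirr.
  apply: leq_trans (_ : size (x :: sval p) <= _) => //; apply: uniq_leq_size ux _.
  by move=> y; rewrite inE => /predU1P[->|]; [exact: rq.1|exact: rp.1].
exists (e @` I); split.
- by move=> _ [x _ <-]; exists x.
- exact: uncountable_image einj ncI.
- pose T' := {x : T | I x}.
  exists T', (fun x y => lt (sval x) (sval y)), (e \o sval); split.
  + split; first exact: (strict_well_order_preim (@sval_inj _ _) ltT.1).
    split=> [x|c]; first exact: (countable_preimage (@sval_inj _ _) (countable_lt (sval x))).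
    apply: ncI; apply: subset_countable (countable_image (sval : T' -> T) c).
    by move=> x Ix; exists (exist _ x Ix).
  + apply: inj_comp einj _; exact: sval_inj.
  + rewrite seteqP; split=> [_ [x _ <-]|_ [x Ix <-]]; last by exists (exist _ x Ix).
    by exists (sval x) => //; exact: (svalP x).
  + move=> w a fw.
    have [n wn] : exists n, forall v, w v -> f v < n.
      have /finite_seqP[s fws] := finite_image f fw.
      exists (\max_(i <- s) i).+1 => v wv; rewrite ltnS.
      apply: (@leq_bigmax_seq _ s xpredT id) => //.
      by have : (f @` w) (f v); [exists v|rewrite fws].
    have [p [Gp ap]] : exists p : P, G p /\ sval a \in sval p.
      by have [p Gp ap] := svalP a; exists p.
    have [q Gq nq] := Gsize n.
    have [r Gr [rp rq]] := Gdir _ _ Gp Gq.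
    have ar := rp.1 _ ap.
    (* All exceptional [b] lie in [r]: any other [b] below [a] enters in some extension of [r]
       within [G], so the two sets meet beyond [size r], which is at least [n], hence outside
       [w]. *)
    apply: sub_finite_set (finite_preimage _ (finite_seq (sval r))).
      move=> b [ba ab]; apply: contrapT => /negP nbr.
      have [p' Gp' bp'] := svalP b; have [r' Gr' [r'r r'p']] := Gdir _ _ Gr Gp'.
      have [v nv [av bv]] := r'r.2 _ _ ar (r'p'.1 _ bp') nbr ba.
      have := wn _ (ab v (conj av bv)); rewrite ltnNge => /negP; apply.
      apply: leq_trans nv; apply: leq_trans nq _.
      exact: extends_size (svalP q).1 rq.
    by move=> x y _ _; exact: sval_inj.
Qed.

End Forcing.
End Omega1.

(** * The dichotomy *)

Theorem theorem0p6 :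
  MA_omega1 ->
  forall (W : Type) (A : set (set W)),
    countable [set: W] -> ~ countable A -> almost_disjoint A ->
    anti_luzin A \/
    exists B : set (set W), [/\ B `<=` A, ~ countable B & luzin B].
Proof.
move=> MA W A /countable_injP[f finj] _ _.
have [|notanti] := pselect (anti_luzin A); [by left|right].
have [B [BA ncB noCD]] : exists B, [/\ B `<=` A, ~ countable B &
    forall C D : set (set W), C `<=` B -> D `<=` B -> ~ countable C -> ~ countable D ->
      ~ finite_set ((\bigcup_(c in C) c) `&` (\bigcup_(d in D) d))].
  apply: contrapT => nB; apply: notanti => B BA ncB; apply: contrapT => nCD.
  apply: nB; exists B; split=> // C D CB DB ncC ncD fin; apply: nCD.
  by exists C, D.
have [T [lt [e [ltT einj eB]]]] := exists_omega1_subset ncB.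
have [x y /finj||C [Ce ncC luzC]] := exists_luzin (f := f) ltT _ einj _ MA.
- by rewrite !inE; apply.
- move=> C D Ce De; apply: noCD; exact: subset_trans eB.
- by exists C; split=> // c /Ce/eB/BA.
Qed.
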